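(* Let $S=\{x_1,x_2,\ldots,x_m\}$ be a gcd-closed set of distinct positive integers with $m>5$. Let $x_n\in S$ be such that $G_S(x_n)=\{x_2,\ldots,x_{n-1}\}$, $\gcd(G_S(x_n))=x_1$ and $D_S(x_n)=\{x_1,x_{n+1},x_{n+2}\}$. If $x_i\mid x_n$ for all $n<i\le m$, then $(S)\nmid[S]$.
   Context: $S$ is gcd-closed if $\gcd(x,y)\in S$ for all $x,y\in S$. The GCD matrix $(S)$ is the $m\times m$ matrix with $(i,j)$-entry $\gcd(x_i,x_j)$; the LCM matrix $[S]$ has $(i,j)$-entry $\mathrm{lcm}(x_i,x_j)$. For $A,B\in M_m(\mathbb{Z})$, $A\mid B$ means there is $C\in M_m(\mathbb{Z})$ with $B=AC$ or $B=CA$; $A\nmid B$ otherwise. For $x<y$ in $S$, $x$ is a greatest-type divisor of $y$ in $S$ if $x\mid y$ and $x\mid z\mid y$, $z\in S$ imply $z\in\{x,y\}$; $G_S(y)$ is the set of greatest-type divisors of $y$ in $S$. If $G_S(x)=\{y_1,\ldots,y_k\}$, then $D_S(x)=\{\gcd(y_{i_1},\ldots,y_{i_r}): 2\le r\le k,\ 1\le i_1<\cdots<i_r\le k\}$. *)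

(* Defs.v *)
From mathcomp Require Import all_boot all_order all_algebra finmap.

Set Implicit Arguments.
Unset Strict Implicit.
Unset Printing Implicit Defensive.

Local Open Scope fset_scope.
Local Open Scope nat_scope.

(* The family x_1, ..., x_m is a function x on nat of which only the values
   at the indices 1, ..., m are used. *)
Definition fam_set (m : nat) (x : nat -> nat) : {fset nat} :=
  [fset x i | i in iota 1 m].

Definition gcd_closed (S : {fset nat}) : Prop :=
  forall a b, a \in S -> b \in S -> gcdn a b \in S.

(* Matrix indices i : 'I_m start at 0, hence the shift. *)
Definition gcd_matrix (m : nat) (x : nat -> nat) : 'M[int]_m :=
  (\matrix_(i, j) Posz (gcdn (x i.+1) (x j.+1)))%R.

Definition lcm_matrix (m : nat) (x : nat -> nat) : 'M[int]_m :=
  (\matrix_(i, j) Posz (lcmn (x i.+1) (x j.+1)))%R.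

Definition mx_dvd (m : nat) (A B : 'M[int]_m) : Prop :=
  exists C : 'M[int]_m, B = (A *m C)%R \/ B = (C *m A)%R.

Definition greatest_type_divisor (S : {fset nat}) (y a : nat) : bool :=
  [&& a < y, a %| y &
      all (fun z => (a %| z) && (z %| y) ==> (z == a) || (z == y)) S].

Definition GS (S : {fset nat}) (y : nat) : {fset nat} :=
  [fset a in S | greatest_type_divisor S y a].

(* 0 is neutral for gcdn; the gcd of the empty set is therefore 0. *)
Definition gcd_set (A : {fset nat}) : nat := \big[gcdn/0]_(a <- A) a.

Definition DS (S : {fset nat}) (y : nat) : {fset nat} :=
  [fset gcd_set A | A in fpowerset (GS S y) & 2 <= #|` A|].

(* Main.v *)
Require Import Defs.
From mathcomp Require Import all_boot all_order all_algebra cyclic finmap.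

(* Let N = x_n, G = G_S(N), and let L(h) = \sum_(A \subset G) (-1)^|A| h(gcd(N, A)), a
   combination of the values of h on S. Writing gcds as sums of totients, L(gcd(z, -))
   vanishes for z in S other than N and is alpha = \sum phi(d) for z = N, the sum being over
   the d | N which divide no y in G. Applying L to a row of [S] = C (S) shows that alpha
   divides beta = L(lcm(a, -)) for all a in S, and beta is the same sum restricted to those d
   which divide no lcm(a, y). If a does not divide every y in G then beta < alpha, hence
   beta = 0, and the term d = N forces lcm(a, y) = N for some y in G.
   Take a = x_(n+1), which divides two elements y_1, y_2 of G. Distributivity gives
   y_i = lcm(a, gcd(y, y_i)) with gcd(y, y_i) in D_S(N); this gcd is neither a nor the divisor
   x_1 of a, so it is x_(n+2) for both i, and y_1 = y_2. *)

Set Implicit Arguments.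
Unset Strict Implicit.
Unset Printing Implicit Defensive.

Import Order.Theory GRing.Theory Num.Theory.

Local Open Scope fset_scope.
Local Open Scope nat_scope.

(** * Totient expansions and alternating sums of gcds *)

Lemma lcmn_gcdr a u v : lcmn a (gcdn u v) = gcdn (lcmn a u) (lcmn a v).
Proof. exact: (@Order.DistrLatticeTheory.joinIr _ natdvd). Qed.

(** Gauss's totient identity with a bound [K] independent of [g], so that expansions for different
    [g] share one index type. *)
Lemma sum_totient_dvd_widen g K :
  0 < g <= K -> g = \sum_(d < K.+1 | d %| g) totient d.
Proof.
case/andP=> g_gt0 leqK; rewrite -{1}(sum_totient_dvd g).
rewrite (big_ord_widen_cond K.+1 (fun d => d %| g)) //.
by apply: eq_bigl => d; case: (boolP (_ %| _)) => // dg; rewrite ltnS dvdn_leq.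
Qed.

(* [alt_gcd_sum s h v] is the sum of [(-1) ^ #|A| * h (gcd of v and A)] over the
   subfamilies [A] of [s]. *)
Fixpoint alt_gcd_sum (s : seq nat) (h : nat -> int) (v : nat) : int :=
  if s is y :: s' then
    (alt_gcd_sum s' h v - alt_gcd_sum s' h (gcdn v y))%R
  else h v.

Lemma eq_alt_gcd_sum s h1 h2 v :
  (forall u, u %| v -> h1 u = h2 u) -> alt_gcd_sum s h1 v = alt_gcd_sum s h2 v.
Proof.
elim: s v => [|y s IHs] v eq_h /=; first exact: eq_h.
by rewrite !IHs // => u u_dvd; apply/eq_h/(dvdn_trans u_dvd)/dvdn_gcdl.
Qed.

Lemma alt_gcd_sum_linear (I : finType) s (c : I -> int) (h : I -> nat -> int) v :
  alt_gcd_sum s (fun u => \sum_i c i * h i u)%R v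
    = (\sum_i c i * alt_gcd_sum s (h i) v)%R.
Proof.
elim: s v => [|y s IHs] v //=.
by rewrite !IHs -sumrB; apply: eq_bigr => i _; rewrite mulrBr.
Qed.

(** Inclusion-exclusion: as [P] turns gcds into conjunctions, the sum factors as [P v] times the
    product of the [1 - P y]. *)
Lemma alt_gcd_sum_pred (P : pred nat) s v :
    (forall u w, P (gcdn u w) = P u && P w) ->
  alt_gcd_sum s (fun u => Posz (P u)) v = Posz (P v && all (predC P) s).
Proof.
move=> P_gcd; elim: s v => [|y s IHs] v /=; first by rewrite andbT.
by rewrite !IHs P_gcd; case: (P v) (P y) (all _ s) => [] [] [].
Qed.

(** Expand [f u] over its divisors [d] and apply inclusion-exclusion to each predicate [d %| f u].
    Both [gcdn z] and [lcmn a] qualify as [f], the latter by distributivity. *)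
Lemma alt_gcd_sum_totient (f : nat -> nat) K s v :
    (forall u w, f (gcdn u w) = gcdn (f u) (f w)) ->
    (forall u, u %| v -> 0 < f u <= K) ->
  alt_gcd_sum s (fun u => Posz (f u)) v
    = Posz (\sum_(d < K.+1 | (d %| f v) && all (fun y => ~~ (d %| f y)) s)
              totient d).
Proof.
move=> f_gcd f_bound.
pose h (d : 'I_K.+1) u := Posz (d %| f u).
rewrite (@eq_alt_gcd_sum _ _ (fun u => \sum_(d < K.+1) Posz (totient d) * h d u)%R).
  rewrite alt_gcd_sum_linear (big_morph Posz PoszD (erefl _)) [RHS]big_mkcond /=.
  apply: eq_bigr => d _; rewrite (alt_gcd_sum_pred (P := fun u => d %| f u)).
    by case: ifP => _; rewrite ?mulr1 ?mulr0.
  by move=> u w; rewrite f_gcd dvdn_gcd.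
move=> u /f_bound/sum_totient_dvd_widen {1}->.
rewrite (big_morph Posz PoszD (erefl _)) big_mkcond /=.
by apply: eq_bigr => d _; rewrite /h; case: ifP => _; rewrite ?mulr1 ?mulr0.
Qed.

(** * Passing from alternating sums to the matrices *)

Lemma fam_setP m x v :
  reflect (exists i : 'I_m, v = x i.+1) (v \in fam_set m x).
Proof.
apply: (iffP (imfsetP _ _ _ _)) => [[k /=] | [i ->]]; last first.
  by exists i.+1; rewrite //= mem_iota add1n !ltnS ltn_ord.
rewrite mem_iota add1n ltnS => /andP[k_gt0 k_le] ->.
have k_lt : k.-1 < m by rewrite prednK.
by exists (Ordinal k_lt); rewrite /= prednK.
Qed.

(** By gcd-closure all evaluation points lie in the family. The weights do not depend on [h], so the
    same combination of columns can be applied to both matrices. *)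
Lemma alt_gcd_sum_comb (m : nat) (x : nat -> nat) s v :
    gcd_closed (fam_set m x) -> {subset s <= fam_set m x} -> v \in fam_set m x ->
  exists w : 'I_m -> int, forall h,
    alt_gcd_sum s h v = (\sum_i w i * h (x i.+1))%R.
Proof.
move=> S_gcd; elim: s v => [|y s IHs] v sS vS /=.
  have /fam_setP[k ->] := vS.
  exists (fun i => (i == k)%:R)%R => h.
  rewrite (bigD1 k) //= eqxx mul1r big1 ?addr0 //.
  by move=> i /negbTE ->; rewrite mul0r.
have yS : y \in fam_set m x by apply: sS; rewrite mem_head.
have sS' : {subset s <= fam_set m x} by move=> z zs; apply: sS; rewrite inE zs orbT.
have [w1 Hw1] := IHs _ sS' vS.
have [w2 Hw2] := IHs _ sS' (S_gcd _ _ vS yS).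
exists (fun i => w1 i - w2 i)%R => h; rewrite Hw1 Hw2 -sumrB.
by apply: eq_bigr => i _; rewrite mulrBl.
Qed.

(* Both matrices are symmetric, so [B = AC] transposes to [B = C^T A]. *)
Lemma mx_dvd_gcd_lcm_left m x :
  mx_dvd (gcd_matrix m x) (lcm_matrix m x) ->
  exists C : 'M[int]_m, lcm_matrix m x = (C *m gcd_matrix m x)%R.
Proof.
case=> C [eqC|eqC]; last by exists C.
exists C^T%R; rewrite -[RHS]trmxK trmx_mul trmxK.
have -> : ((gcd_matrix m x)^T = gcd_matrix m x)%R.
  by apply/matrixP=> i j; rewrite !mxE gcdnC.
by rewrite -eqC; apply/matrixP=> i j; rewrite !mxE lcmnC.
Qed.

(** * Greatest-type divisors and their gcds *)

Lemma DS_pair S N y1 y2 :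
  y1 \in GS S N -> y2 \in GS S N -> y1 != y2 -> gcdn y1 y2 \in DS S N.
Proof.
move=> y1G y2G neq; apply/imfsetP; exists [fset y1; y2] => /=.
  rewrite !inE fpowersetE cardfs2 neq andbT.
  by apply/fsubsetP => z; rewrite in_fset2 => /orP[] /eqP->.
by rewrite /gcd_set big_fsetU1 ?inE // big_seq_fset1.
Qed.

Lemma gcd_set_dvd (A : {fset nat}) y : y \in A -> gcd_set A %| y.
Proof. by move=> yA; rewrite /gcd_set (big_fsetD1 y) //= dvdn_gcdl. Qed.

Lemma dvd_gcd_set (A : {fset nat}) a :
  (forall y, y \in A -> a %| y) -> a %| gcd_set A.
Proof.
move=> a_dvd; rewrite /gcd_set big_seq.
apply: (big_ind (fun g => a %| g)) => // u v au av.
by rewrite dvdn_gcd au.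
Qed.

Lemma gcd_set_GS_dvd S N a : a \in DS S N -> gcd_set (GS S N) %| a.
Proof.
case/imfsetP=> /= A; rewrite !inE fpowersetE => /andP[/fsubsetP AG _] ->.
by apply: dvd_gcd_set => y /AG/gcd_set_dvd.
Qed.

Lemma DS_dvd_two S N a : a \in DS S N ->
  exists y1 y2, [/\ y1 \in GS S N, y2 \in GS S N, y1 != y2, a %| y1 & a %| y2].
Proof.
case/imfsetP=> /= A; rewrite !inE fpowersetE => /andP[/fsubsetP AG A_ge2] ->.
have /fset0Pn[y1 y1A] : A != fset0 by rewrite -cardfs_gt0 ltnW.
have /fset0Pn[y2] : A `\ y1 != fset0.
  by move: A_ge2; rewrite (cardfsD1 y1) y1A -cardfs_gt0.
rewrite !inE => /andP[neq y2A].
by exists y1, y2; split; rewrite ?AG ?gcd_set_dvd // eq_sym.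
Qed.

(** If [a] is not of greatest type, some [z] in [S] lies strictly between [a] and [N] for
    divisibility; replacing [a] by [z] decreases [N - a]. *)
Lemma GS_above S N a : a \in S -> a < N -> a %| N ->
  exists2 y, y \in GS S N & a %| y.
Proof.
elim: {a}(N - a) {-2}a (leqnn (N - a)) => [|k IHk] a le_k aS lt_aN a_dvd.
  by move: lt_aN; rewrite -subn_gt0 ltnNge le_k.
have [gtd | not_gtd] := boolP (greatest_type_divisor S N a).
  by exists a => //; rewrite !inE aS gtd.
move: not_gtd; rewrite /greatest_type_divisor lt_aN a_dvd /= => /allPn[z zS].
rewrite negb_imply negb_or => /and3P[/andP[az zN] neq_za neq_zN].
have N_gt0 : 0 < N by apply: leq_ltn_trans lt_aN.
have z_gt0 : 0 < z by apply: dvdn_gt0 zN.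
have lt_az : a < z by rewrite ltn_neqAle eq_sym neq_za dvdn_leq.
have lt_zN : z < N by rewrite ltn_neqAle neq_zN dvdn_leq.
have [|y yG zy] := IHk z _ zS lt_zN zN.
  by rewrite -ltnS (leq_trans _ le_k) // ltn_sub2l.
by exists y => //; apply: dvdn_trans zy.
Qed.

Lemma GS_antichain S N y z :
  y \in GS S N -> z \in GS S N -> y %| z -> y = z.
Proof.
rewrite !inE => /andP[_ /and3P[_ _ /allP y_max]] /andP[zS /and3P[lt_zN zN _]] yz.
have := y_max z zS; rewrite yz zN /= => /orP[/eqP-> //|/eqP eq_zN].
by rewrite eq_zN ltnn in lt_zN.
Qed.

(** * Consequence of matrix divisibility for lcms with [G_S(N)] *)

Lemma mx_dvd_lcm_GS m x N a y0 :
    (forall i : 'I_m, 0 < x i.+1) ->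
    (forall i j : 'I_m, x i.+1 = x j.+1 -> i = j) ->
    gcd_closed (fam_set m x) -> mx_dvd (gcd_matrix m x) (lcm_matrix m x) ->
    N \in fam_set m x -> (forall z, z \in fam_set m x -> z %| N) ->
    a \in fam_set m x -> y0 \in GS (fam_set m x) N -> ~~ (a %| y0) ->
  exists2 y, y \in GS (fam_set m x) N & lcmn a y = N.
Proof.
set S := fam_set m x; set G := GS S N.
move=> x_pos x_inj S_gcd /mx_dvd_gcd_lcm_left[C eqC] NS S_dvd aS y0G a_ndvd.
have x_pos' z : z \in S -> 0 < z by case/fam_setP=> i ->.
have G_S y : y \in G -> y \in S by rewrite !inE => /andP[].
have G_dvd y : y \in G -> y %| N by move/G_S/S_dvd.
have [N_gt0 a_gt0 aN] := And3 (x_pos' N NS) (x_pos' a aS) (S_dvd a aS).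
have [w Hw] := @alt_gcd_sum_comb m x (enum_fset G) N S_gcd G_S NS.
have [/fam_setP[i_N N_eq] /fam_setP[i_a a_eq]] := (NS, aS).
pose alpha := \sum_(d < N.+1
  | (d %| N) && all (fun y => ~~ (d %| y)) (enum_fset G)) totient d.
pose beta := \sum_(d < N.+1
  | (d %| N) && all (fun y => ~~ (d %| lcmn a y)) (enum_fset G)) totient d.
have gcd_sum (i : 'I_m) :
    (\sum_k w k * Posz (gcdn (x i.+1) (x k.+1)) = Posz alpha *+ (i == i_N))%R.
  rewrite -(Hw (fun u => Posz (gcdn (x i.+1) u))).
  have xiS : x i.+1 \in S by apply/fam_setP; exists i.
  rewrite (@alt_gcd_sum_totient (gcdn (x i.+1)) N); first last.
  - move=> u uN; rewrite gcdn_gt0 x_pos' //= dvdn_leq //.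
    exact: dvdn_trans (dvdn_gcdr _ _) uN.
  - by move=> u v; rewrite gcdnACA gcdnn.
  have [->|neq_in] := eqVneq i i_N.
    rewrite -N_eq; congr Posz; apply: eq_big => // d.
    rewrite gcdnn; congr (_ && _); apply: eq_in_all => y yG.
    by rewrite (gcdn_idPr (G_dvd _ yG)).
  (* A proper divisor [x i.+1] of [N] divides some [y] in [G], and this [y] rules out every [d]
     dividing [x i.+1]. *)
  have [||y yG xi_y] := @GS_above S N (x i.+1) xiS; rewrite ?S_dvd //.
    rewrite ltn_neqAle dvdn_leq ?S_dvd // andbT; apply: contraNneq neq_in => eqN.
    by rewrite N_eq in eqN; apply/eqP/x_inj.
  rewrite big_pred0 // => d; apply/negP => /andP[d_dvd /allP/(_ y yG)/negP[]].
  move: d_dvd; rewrite (gcdn_idPl (S_dvd _ xiS)) => d_dvd.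
  by rewrite (gcdn_idPl xi_y).
have lcm_sum : (\sum_k w k * Posz (lcmn a (x k.+1)) = Posz beta)%R.
  rewrite -(Hw (fun u => Posz (lcmn a u))) (@alt_gcd_sum_totient (lcmn a) N).
  - by rewrite (lcmn_idPr aN).
  - exact: lcmn_gcdr.
  - move=> u uN; rewrite lcmn_gt0 a_gt0 (dvdn_gt0 N_gt0 uN) dvdn_leq //.
    by rewrite dvdn_lcm aN.
have eq_beta : Posz beta = (C i_a i_N * Posz alpha)%R.
  rewrite -lcm_sum.
  (* Combine row [i_a] of [eqC] with the weights [w]; by [gcd_sum] only [l = i_N] survives. *)
  transitivity (\sum_l C i_a l * \sum_k w k * Posz (gcdn (x l.+1) (x k.+1)))%R.
    under [RHS]eq_bigr do rewrite mulr_sumr.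
    rewrite exchange_big; apply: eq_bigr => k _ /=.
    have /matrixP/(_ i_a k) := eqC; rewrite !mxE /= -a_eq => ->.
    by rewrite mulr_sumr; apply: eq_bigr => l _; rewrite !mxE mulrCA.
  rewrite (bigD1 i_N) // gcd_sum eqxx big1 /= ?addr0 // => l /negbTE neq_l.
  by rewrite gcd_sum neq_l mulr0.
have lt_beta_alpha : beta < alpha.
  (* The term [d = lcmn a y0] occurs in [alpha] but not in [beta]: if it divided some [z] in [G],
     then [y0 %| z] would give [z = y0], hence [a %| y0]. The other terms of [beta] all occur in
     [alpha]. *)
  have lcm_le : lcmn a y0 < N.+1 by rewrite ltnS dvdn_leq // dvdn_lcm aN G_dvd.
  rewrite /alpha (bigD1 (Ordinal lcm_le)) /=; last first.
    rewrite dvdn_lcm aN G_dvd //=; apply/allP => z zG; rewrite dvdn_lcm.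
    by apply: contra a_ndvd => /andP[az /(GS_antichain y0G zG)->].
  rewrite -add1n leq_add ?totient_gt0 ?lcmn_gt0 ?a_gt0 ?x_pos' ?G_S //.
  rewrite /beta big_mkcond [leqRHS]big_mkcond; apply: leq_sum => d _.
  case: ifP => // /andP[dN /allP d_ndvd]; rewrite ifT // dN /=; apply/andP; split.
    apply/allP => z zG; apply: contra (d_ndvd z zG) => dz.
    by rewrite (dvdn_trans dz) ?dvdn_lcmr.
  by apply: contraNneq (d_ndvd y0 y0G) => ->.
have beta0 : beta = 0.
  have alpha_gt0 : (0 < Posz alpha)%R by apply: leq_ltn_trans lt_beta_alpha.
  have C_ge0 : (0 <= C i_a i_N)%R by rewrite -(pmulr_lge0 _ alpha_gt0) -eq_beta.
  have C_lt1 : (C i_a i_N < 1)%R.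
    by rewrite -(ltr_pM2r alpha_gt0) mul1r -eq_beta ltz_nat.
  case: (C i_a i_N) C_ge0 C_lt1 eq_beta => [[|k]|k] // _ _.
  by rewrite mul0r => -[].
have /allPn[y yG] : ~~ all (fun y => ~~ (N %| lcmn a y)) (enum_fset G).
  apply/negP => all_N; move: beta0; rewrite /beta (bigD1 ord_max) /= ?dvdnn //.
  by apply/eqP; rewrite addn_eq0 -leqn0 leqNgt totient_gt0 N_gt0.
rewrite negbK => N_dvd; exists y => //; apply/eqP.
by rewrite eqn_dvd N_dvd dvdn_lcm aN G_dvd.
Qed.

(** * The contradiction at [x (n + 1)] *)

Theorem theorem3p3 (m n : nat) (x : nat -> nat)
    (x_pos : forall i, 1 <= i <= m -> 0 < x i)
    (x_inj : forall i j, 1 <= i <= m -> 1 <= j <= m -> x i = x j -> i = j)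
    (S_gcd_closed : gcd_closed (fam_set m x))
    (m_gt5 : 5 < m)
    (n_ge1 : 1 <= n)
    (n2_le_m : n + 2 <= m)
    (GS_xn : GS (fam_set m x) (x n) = [fset x i | i in index_iota 2 n])
    (gcd_GS_xn : gcd_set (GS (fam_set m x) (x n)) = x 1)
    (DS_xn : DS (fam_set m x) (x n) = [fset x 1; x (n + 1); x (n + 2)])
    (dvd_xn : forall i, n < i <= m -> x i %| x n) :
  ~ mx_dvd (gcd_matrix m x) (lcm_matrix m x).
Proof.
move=> mx_S.
set S := fam_set m x in S_gcd_closed GS_xn gcd_GS_xn DS_xn.
set N := x n in GS_xn gcd_GS_xn DS_xn dvd_xn.
set G := GS S N in GS_xn gcd_GS_xn DS_xn.
pose a := x (n + 1).
have range i : (1 <= i <= m) -> x i \in S.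
  by move=> i_range; apply/imfsetP; exists i; rewrite //= mem_iota add1n ltnS.
have n_range : 1 <= n <= m by rewrite n_ge1 (leq_trans _ n2_le_m) ?leq_addr.
have a_range : 1 <= n + 1 <= m.
  by rewrite addn1 (leq_trans _ n2_le_m) // addn2.
have NS : N \in S by apply: range.
have aS : a \in S by apply: range.
have G_lt y : y \in G -> y < N by rewrite !inE => /and3P[_ ? _].
have G_dvd y : y \in G -> y %| N by rewrite !inE => /and4P[].
have neq_a_x1 : a != x 1.
  apply/eqP=> /x_inj; rewrite a_range /= (leq_trans _ m_gt5) // => /(_ isT isT).
  by rewrite addn1 => -[n0]; rewrite n0 in n_ge1.
have aD : a \in DS S N by rewrite DS_xn !inE eqxx orbT.
have [y1 [y2 [y1G y2G neq_y ay1 ay2]]] := DS_dvd_two aD.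
have S_dvd z : z \in S -> z %| N.
  case/imfsetP=> /= i; rewrite mem_iota add1n ltnS => /andP[i_gt0 i_le] ->.
  have [lt_in|lt_ni|->//] := ltngtP i n; last by apply: dvd_xn; rewrite lt_ni.
  have [lt_1i|] := ltnP 1 i.
    apply: G_dvd; rewrite GS_xn; apply/imfsetP; exists i => //=.
    by rewrite mem_index_iota lt_1i.
  rewrite -[i <= 1]/(i < 2) ltnS => le_i1.
  have -> : i = 1 by apply/eqP; rewrite eqn_leq le_i1.
  (* Here [y1] witnesses that [G] is nonempty; the gcd of an empty [G] would be 0. *)
  by rewrite -gcd_GS_xn (dvdn_trans (gcd_set_dvd y1G)) ?G_dvd.
have [y yG lcm_ay] : exists2 y, y \in G & lcmn a y = N.
  have [y0 y0G a_ndvd] : exists2 y, y \in G & ~~ (a %| y).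
    (* Otherwise [a] divides the gcd [x 1] of [G], which divides every element of [DS S N], so
       [a = x 1]. *)
    apply/allPn/negP => /allP a_dvd.
    have a_x1 : a %| x 1 by rewrite -gcd_GS_xn; apply: dvd_gcd_set.
    by move: neq_a_x1; rewrite eqn_dvd a_x1 -gcd_GS_xn gcd_set_GS_dvd.
  apply: (mx_dvd_lcm_GS _ _ S_gcd_closed mx_S NS S_dvd aS y0G a_ndvd) => [i | i j eq_x].
    (* The range condition on [i.+1] computes to [i < m]. *)
    by apply: x_pos; apply: ltn_ord.
  by apply/val_inj/succn_inj; apply: x_inj eq_x; apply: ltn_ord.
have y_eq z : z \in G -> a %| z -> z = lcmn a (x (n + 2)).
  move=> zG az.
  (* If [a] were in [G], the antichain property would give [y1 = a = y2]. *)
  have z_neq_a : z != a.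
    apply/eqP=> z_a; rewrite -z_a in ay1 ay2; move: neq_y.
    by rewrite -(GS_antichain zG y1G ay1) (GS_antichain zG y2G ay2) eqxx.
  have z_eq : z = lcmn a (gcdn y z).
    by rewrite lcmn_gcdr lcm_ay (lcmn_idPr az) gcdnC; apply/esym/gcdn_idPl/G_dvd.
  (* If [y = z], then [a %| y] and [lcmn a y] is [y], which is less than [N]. *)
  have neq_yz : y != z.
    apply/eqP=> eq_yz; have := G_lt _ zG.
    by rewrite -lcm_ay eq_yz (lcmn_idPr az) ltnn.
  have := DS_pair yG zG neq_yz; rewrite DS_xn !inE -/a => /orP[/orP[]|] /eqP gcd_eq.
  - have x1_a : x 1 %| a by rewrite -gcd_GS_xn gcd_set_GS_dvd.
    by case/eqP: z_neq_a; rewrite z_eq gcd_eq (lcmn_idPl x1_a).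
  - by case/eqP: z_neq_a; rewrite z_eq gcd_eq (lcmn_idPl (dvdnn a)).
  - by rewrite -gcd_eq.
by move: neq_y; rewrite (y_eq y1) // -(y_eq y2) // eqxx.
Qed.
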